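(* Let $f:\mathbb{R}^n\to\mathbb{R}$ be convex, differentiable and $L$-smooth, i.e. $\|\nabla f(x)-\nabla f(y)\|_2\le L\|x-y\|_2$ for all $x,y\in\mathbb{R}^n$, and let $h:\mathbb{R}^n\to(-\infty,+\infty]$ be proper, closed and convex. Let $x^\star\in\operatorname{argmin}_{x}\{f(x)+h(x)\}$ and assume: (i) $f$ is of class $C^2$ around $x^\star$ and there is a real $\nu>0$ such that $\nabla^2 f(x^\star)\succeq \nu I$; (ii) $h$ is twice epi-differentiable at $x^\star$ for the vector $-\nabla f(x^\star)$, and the corresponding second-order epi-derivative is generalized quadratic: $\Delta^2_{x^\star,-\nabla f(x^\star)}h(\xi)=\tfrac12\langle \xi,Q\xi\rangle$ for $\xi\in S$ and $=+\infty$ otherwise, where $S$ is a linear subspace of $\mathbb{R}^n$ and $Q\in\mathbb{R}^{n\times n}$ is a symmetric matrix; (iii) there exists a constant $M_\alpha$ such that the extrapolation coefficients $\alpha^k$ computed by the AA-PGA algorithm (described in the context) satisfy $\|\alpha^k\|_1\le M_\alpha$ for all $k\in\mathbb{N}_+$. Let $\gamma\in(0,1/L]$, let $g(y)=\operatorname{prox}_{\gamma h}(y)-\gamma\nabla f(\operatorname{prox}_{\gamma h}(y))$, let $F(y)=g(y)-y$, and let $y^\star=x^\star-\gamma\nabla f(x^\star)$ be a fixed point of $g$. Let $G$ be the Jacobian of $g$ at $y^\star$ (which exists under (i) and (ii)), define $\rho(G)=\|G\|_2$ (spectral norm), and let $\hat\rho$ be a real constant satisfying $\hat\rho\in(\rho(G),1)$.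 If $y_0$ is initialized sufficiently close to $y^\star$, then, for any fixed $m\in\mathbb{N}$, the iterates $\{x_k\}$ and $\{y_k\}$ formed by AA-PGA with memory parameter $m$ and step size $\gamma$ satisfy $$\|F(y_k)\|_2\le\hat\rho^{\,k}\|F(y_0)\|_2\qquad\text{and}\qquad \|x_k-x^\star\|_2\le\frac{3+\rho(G)}{1-\rho(G)}\,\hat\rho^{\,k}\,\|y_0-y^\star\|_2 .$$ Moreover, $$\limsup_{k\to\infty}\left(\frac{\|F(y_k)\|_2}{\|F(y_0)\|_2}\right)^{1/k}\le\rho(G)\qquad\text{and}\qquad\limsup_{k\to\infty}\left(\frac{\|x_k-x^\star\|_2}{\|x_0-x^\star\|_2}\right)^{1/k}\le\rho(G).$$
   Context: Notation: $\|\cdot\|$ denotes a general norm and $\|\cdot\|_2$ the Euclidean norm (spectral norm for matrices). Proximal operator: $\operatorname{prox}_{\gamma h}(y)=\operatorname{argmin}_x\{\gamma h(x)+\tfrac12\|x-y\|_2^2\}$. Epi-convergence: functions $q_t:\mathbb{R}^n\to[-\infty,+\infty]$, $t>0$, epi-converge to $q$ as $t\downarrow0$ if for every sequence $t_j\downarrow 0$ and every $\xi\in\mathbb{R}^n$: $\liminf_j q_{t_j}(\xi_j)\ge q(\xi)$ for every sequence $\xi_j\to\xi$, and $\limsup_j q_{t_j}(\xi_j)\le q(\xi)$ for some sequence $\xi_j\to\xi$. A function $h$ is epi-differentiable at $x$ if the first-order difference quotients $\xi\mapsto [h(x+t\xi)-h(x)]/t$ epi-converge as $t\downarrow0$. It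 is twice epi-differentiable at $x$ for a vector $v\in\mathbb{R}^n$ if it is epi-differentiable at $x$ and the second-order quotients $$\Delta^2_{x,v,t}h(\xi)=\frac{h(x+t\xi)-h(x)-t\langle v,\xi\rangle}{t^2/2},\qquad t>0,$$ epi-converge to a proper function as $t\downarrow 0$. The limit, denoted $\Delta^2_{x,v}h$, is the second-order epi-derivative. AA-PGA (Anderson accelerated proximal gradient algorithm) with memory parameter $m\ge 0$ and step size $\gamma$: start with $x_0=y_0$, set $y_1=x_0-\gamma\nabla f(x_0)$, $x_1=\operatorname{prox}_{\gamma h}(y_1)$, $g_0=y_1$, $r_0=g_0-y_0$. For $k=1,2,\dots$: let $m_k=\min(m,k)$, $g_k=x_k-\gamma\nabla f(x_k)$, $r_k=g_k-y_k$, $R_k=[r_k,\dots,r_{k-m_k}]$; compute $$\alpha^k=(\alpha^k_0,\dots,\alpha^k_{m_k})^\top=\operatorname{argmin}_{\alpha:\ \sum_i\alpha_i=1}\|R_k\alpha\|;$$ set $y_{k+1}=\sum_{i=0}^{m_k}\alpha_i^k g_{k-i}$ and $x_{k+1}=\operatorname{prox}_{\gamma h}(y_{k+1})$.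
   Formalization: The algorithm is started with x_0 = prox_{γh}(y_0) instead of x_0 = y_0, and the norm in the argmin defining α^k is the Euclidean norm instead of a general norm; the claim fails without either change. *)

(* Defs.v *)
(* MathComp-Analysis.  Vectors of R^n are rows 'rV[R]_n.  The library norm on
   'rV[R]_n is the sup norm; it is used only through the topology it induces.
   All metric statements use the Euclidean norm [enorm]. *)
From HB Require Import structures.
From mathcomp Require Import all_boot all_order all_algebra.
From mathcomp Require Import all_classical all_reals all_analysis.
Set Implicit Arguments.
Unset Strict Implicit.
Unset Printing Implicit Defensive.
Import Order.TTheory GRing.Theory Num.Theory.
Import numFieldNormedType.Exports.
Local Open Scope classical_set_scope.
Local Open Scope ring_scope.

Definition dot (R : realType) (n : nat) (u v : 'rV[R]_n) : R :=
  \sum_i u 0 i * v 0 i.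

Definition enorm (R : realType) (n : nat) (u : 'rV[R]_n) : R :=
  Num.sqrt (dot u u).

(* Matrices act on rows from the right, in agreement with the library's
   jacobian ('d f p u = u *m 'J f p), which is thus the transpose of the
   column-vector Jacobian; the spectral norm does not see the difference. *)
Definition spectral_norm (R : realType) (n : nat) (A : 'M[R]_n) : R :=
  sup [set enorm (u *m A) | u in [set u : 'rV[R]_n | enorm u <= 1]].

Definition grad (R : realType) (n : nat) (f : 'rV[R]_n -> R) (x : 'rV[R]_n) :
    'rV[R]_n :=
  \row_i 'D_(delta_mx 0 i) f x.

Definition hessian (R : realType) (n : nat) (f : 'rV[R]_n -> R)
    (x : 'rV[R]_n) : 'M[R]_n :=
  'J (grad f) x.

(* To be used for an f that is differentiable everywhere. *)
Definition class_C2_around (R : realType) (n : nat) (f : 'rV[R]_n -> R)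
    (x : 'rV[R]_n) : Prop :=
  \forall z \near x,
    differentiable (grad f) z /\ {for z, continuous (hessian f)}.

Definition lsmooth (R : realType) (n : nat) (L : R) (f : 'rV[R]_n -> R) :
    Prop :=
  forall x y, enorm (grad f x - grad f y) <= L * enorm (x - y).

Definition proper_efun (R : realType) (n : nat) (q : 'rV[R]_n -> \bar R) : Prop :=
  (forall x, q x != -oo%E) /\ exists x, (q x < +oo)%E.

(* Intended for functions that never take the value -oo; 0 * +oo = 0. *)
Definition ext_convex (R : realType) (n : nat) (q : 'rV[R]_n -> \bar R) :
    Prop :=
  forall (t : R) (x y : 'rV[R]_n), 0 <= t <= 1 ->
    (q (t *: x + (1 - t) *: y)%R <= t%:E * q x + (1 - t)%:E * q y)%E.

Definition argmin (R : realType) (n : nat) (q : 'rV[R]_n -> \bar R) :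
    set 'rV[R]_n :=
  [set x | forall z, (q x <= q z)%E].

(* The minimizer is chosen by [xget]; it is unique for gamma > 0 and h proper,
   closed and convex. *)
Definition prox (R : realType) (n : nat) (gamma : R) (h : 'rV[R]_n -> \bar R)
    (y : 'rV[R]_n) : 'rV[R]_n :=
  xget 0 (argmin (fun x => gamma%:E * h x + (2^-1 * enorm (x - y)%R ^+ 2)%:E)%E).

Definition epi_converges (R : realType) (n : nat)
    (q_ : R -> 'rV[R]_n -> \bar R) (q : 'rV[R]_n -> \bar R) : Prop :=
  forall (t : nat -> R), (forall j, 0 < t j) -> t @ \oo --> (0 : R) ->
  forall xi : 'rV[R]_n,
    (forall xi_ : nat -> 'rV[R]_n, xi_ @ \oo --> xi ->
       (q xi <= limn_einf (fun j => q_ (t j) (xi_ j)))%E) /\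
    (exists2 xi_ : nat -> 'rV[R]_n, xi_ @ \oo --> xi &
       (limn_esup (fun j => q_ (t j) (xi_ j)) <= q xi)%E).

Definition quotient1 (R : realType) (n : nat) (h : 'rV[R]_n -> \bar R)
    (x : 'rV[R]_n) (t : R) (xi : 'rV[R]_n) : \bar R :=
  ((t^-1)%:E * (h (x + t *: xi)%R - h x))%E.

Definition quotient2 (R : realType) (n : nat) (h : 'rV[R]_n -> \bar R)
    (x v : 'rV[R]_n) (t : R) (xi : 'rV[R]_n) : \bar R :=
  (((t ^+ 2 / 2)^-1)%:E * (h (x + t *: xi)%R - h x - (t * dot v xi)%:E))%E.

Definition epi_differentiable (R : realType) (n : nat)
    (h : 'rV[R]_n -> \bar R) (x : 'rV[R]_n) : Prop :=
  exists q, epi_converges (quotient1 h x) q.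

Definition is_second_epi_derivative (R : realType) (n : nat)
    (h : 'rV[R]_n -> \bar R) (x v : 'rV[R]_n) (q : 'rV[R]_n -> \bar R) : Prop :=
  proper_efun q /\ epi_converges (quotient2 h x v) q.

Definition twice_epi_differentiable (R : realType) (n : nat)
    (h : 'rV[R]_n -> \bar R) (x v : 'rV[R]_n) : Prop :=
  epi_differentiable h x /\ exists q, is_second_epi_derivative h x v q.

Definition generalized_quadratic (R : realType) (n : nat)
    (S : {vspace 'rV[R]_n}) (Q : 'M[R]_n) (xi : 'rV[R]_n) : \bar R :=
  if xi \in S then (2^-1 * dot xi (xi *m Q))%:E else +oo%E.

Definition grad_step (R : realType) (n : nat) (gradf : 'rV[R]_n -> 'rV[R]_n)
    (gamma : R) (x : 'rV[R]_n) : 'rV[R]_n :=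
  x - gamma *: gradf x.

Definition pga_map (R : realType) (n : nat)
    (gradf px : 'rV[R]_n -> 'rV[R]_n) (gamma : R) (y : 'rV[R]_n) : 'rV[R]_n :=
  grad_step gradf gamma (px y).

(* The rows are r_k, ..., r_(k - m_k) with r_j = g_j - y_j and
   m_k = min(m, k). *)
Definition residual_mx (R : realType) (n : nat)
    (gradf : 'rV[R]_n -> 'rV[R]_n) (gamma : R) (x y : nat -> 'rV[R]_n)
    (m k : nat) : 'M[R]_((minn m k).+1, n) :=
  \matrix_(i < (minn m k).+1)
    (grad_step gradf gamma (x (k - i)%N) - y (k - i)%N).

(* The sequences x, y, alpha form a run of the accelerated method, px standing
   for prox_(gamma h) and N for the norm in the least-residual problem, whose
   minimizer need not be unique: any minimizer is allowed.  alpha 0 plays no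
   role.  The run starts from y 0 with x 0 = px (y 0), so that g_0 is the
   image of y 0 under pga_map and r_0 is the fixed-point residual at y 0;
   with x 0 = y 0 instead, a run started at a fixed point of pga_map would in
   general leave it unless h = 0. *)
Record aa_pga (R : realType) (n : nat) (N : 'rV[R]_n -> R)
    (gradf px : 'rV[R]_n -> 'rV[R]_n) (gamma : R) (m : nat)
    (x y : nat -> 'rV[R]_n)
    (alpha : forall k : nat, 'rV[R]_(minn m k).+1) : Prop := {
  aa_prox : forall k, x k = px (y k) ;
  aa_y1 : y 1%N = grad_step gradf gamma (x 0%N) ;
  aa_sum1 : forall k, (0 < k)%N -> \sum_i alpha k 0 i = 1 ;
  aa_min : forall k, (0 < k)%N ->
    forall beta : 'rV[R]_(minn m k).+1, \sum_i beta 0 i = 1 ->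
      N (alpha k *m residual_mx gradf gamma x y m k) <=
      N (beta *m residual_mx gradf gamma x y m k) ;
  aa_step : forall k, (0 < k)%N ->
    y k.+1 = \sum_i alpha k 0 i *: grad_step gradf gamma (x (k - i)%N)
}.

(* Main.v *)
Require Import Defs.
From HB Require Import structures.
From mathcomp Require Import all_boot all_order all_algebra.
From mathcomp Require Import all_classical all_reals all_analysis.
From mathcomp Require Import ring lra.
Set Implicit Arguments.
Unset Strict Implicit.
Unset Printing Implicit Defensive.
Import Order.TTheory GRing.Theory Num.Theory.
Import numFieldNormedType.Exports.
Local Open Scope classical_set_scope.
Local Open Scope ring_scope.

(** Two facts carry the theorem.

    The fixed-point map g is differentiable at ystar = xstar - gamma grad f
    (xstar).  Only the proximal operator needs an argument.  By optimality
    v = - grad f (xstar) is a subgradient of h at xstar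
    ([argmin_subgradient]), so prox (xstar + gamma v) = xstar.  The difference
    quotient of prox at xstar + gamma v in the direction xi minimizes over w
        gamma / 2 * quotient2 h xstar v t w + |w - xi|^2 / 2
    ([prox_quotient_min]).  When t tends to 0, epi-convergence carries
    minimality over to the limiting problem, where the second-order epi-derivative
    replaces the quotient ([prox_quotient_limit]).  That problem minimizes a
    strongly convex quadratic on the subspace S, hence its solution is unique
    and linear in xi ([quadratic_prox_matrix], [quadratic_prox_growth]).  As
    prox is nonexpansive, the quotients stay bounded and a compactness argument
    makes the convergence uniform in xi: prox is differentiable
    ([prox_differentiable]).

    Near ystar the method behaves as it does on a linear map, whose matrix G is
    the Jacobian of g at ystar.  If y' = sum_i a_i g (z_i) with
    sum_i a_i = 1, then to first order F y' = (sum_i a_i F (z_i)) G ([mixture_residual_le]).  The weights of the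
    method minimize the norm of the mixed residual, which is therefore at most
    |F (y k)|; whence |F (y k.+1)| <= rho |F (y k)| + (small) * max_i
    |F (y (k - i))|, the maximum running over a window of length m.  On a
    sequence that decays like r^k the window costs a factor r^-m, and a small
    enough neighbourhood of ystar absorbs it ([delayed_contraction]).  Errors
    and residuals are comparable as G has norm less than 1, which gives the
    bounds on x.  Since the iterates converge, the same recursion can be
    restarted late in the run with any rate s between rho and 1; this gives the root rates
    ([mixing_local_convergence]). *)

(** * Euclidean geometry of row vectors *)

Section Euclid.
Variables (R : realType) (n : nat).
Implicit Types (u v w : 'rV[R]_n) (a : R).

Lemma dotC u v : dot u v = dot v u.
Proof. by apply: eq_bigr => i _; rewrite mulrC. Qed.

Lemma dotDl u v w : dot (u + v) w = dot u w + dot v w.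
Proof. by rewrite -big_split; apply: eq_bigr => i _; rewrite mxE mulrDl. Qed.

Lemma dotZl a u v : dot (a *: u) v = a * dot u v.
Proof. by rewrite mulr_sumr; apply: eq_bigr => i _; rewrite mxE mulrA. Qed.

Lemma dotNl u v : dot (- u) v = - dot u v.
Proof. by rewrite -scaleN1r dotZl mulN1r. Qed.

Lemma dotBl u v w : dot (u - v) w = dot u w - dot v w.
Proof. by rewrite dotDl dotNl. Qed.

Lemma dotDr u v w : dot w (u + v) = dot w u + dot w v.
Proof. by rewrite !(dotC w) dotDl. Qed.

Lemma dotZr a u v : dot u (a *: v) = a * dot u v.
Proof. by rewrite !(dotC u) dotZl. Qed.

Lemma dotNr u v : dot u (- v) = - dot u v.
Proof. by rewrite !(dotC u) dotNl. Qed.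

Lemma dotBr u v w : dot w (u - v) = dot w u - dot w v.
Proof. by rewrite !(dotC w) dotBl. Qed.

Lemma dot0l u : dot 0 u = 0.
Proof. by rewrite -(scale0r 0) dotZl mul0r. Qed.

Lemma dotE u v : dot u v = (u *m v^T) 0 0.
Proof. by rewrite mxE; apply: eq_bigr => i _; rewrite mxE. Qed.

Lemma dot_mulmxl u v (A : 'M[R]_n) : dot (u *m A) v = dot u (v *m A^T).
Proof. by rewrite !dotE trmx_mul trmxK mulmxA. Qed.

Lemma dot_ge0 u : 0 <= dot u u.
Proof. by apply: sumr_ge0 => i _; rewrite -expr2 sqr_ge0. Qed.

Lemma enorm_ge0 u : 0 <= enorm u.
Proof. exact: sqrtr_ge0. Qed.

Lemma enorm_sqr u : enorm u ^+ 2 = dot u u.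
Proof. by rewrite sqr_sqrtr// dot_ge0. Qed.

Lemma enorm0 : enorm (0 : 'rV[R]_n) = 0.
Proof. by rewrite /enorm dot0l sqrtr0. Qed.

Lemma enormZ a u : enorm (a *: u) = `|a| * enorm u.
Proof.
by rewrite /enorm dotZl dotZr mulrA -expr2 sqrtrM ?sqr_ge0// sqrtr_sqr.
Qed.

Lemma enormN u : enorm (- u) = enorm u.
Proof. by rewrite -scaleN1r enormZ normrN1 mul1r. Qed.

Lemma enormBC u v : enorm (u - v) = enorm (v - u).
Proof. by rewrite -enormN opprB. Qed.

Lemma coord_le_enorm u i : `|u 0 i| <= enorm u.
Proof.
rewrite -sqrtr_sqr ler_wsqrtr// /dot (bigD1 i)//= expr2 lerDl.
by apply: sumr_ge0 => j _; rewrite -expr2 sqr_ge0.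
Qed.

Lemma enorm_eq0 u : enorm u = 0 -> u = 0.
Proof.
move=> u0; apply/rowP => i; rewrite mxE; apply/normr0_eq0/le_anti.
by rewrite normr_ge0 -u0 coord_le_enorm.
Qed.

Lemma Cauchy_Schwarz u v : dot u v <= enorm u * enorm v.
Proof.
have [/enorm_eq0->|v0] := eqVneq (enorm v) 0.
  by rewrite dotC dot0l enorm0 mulr0.
have v_gt0 : 0 < enorm v by rewrite lt_def v0 enorm_ge0.
(* |v|^2 times the component of u orthogonal to v *)
have := dot_ge0 (enorm v ^+ 2 *: u - dot u v *: v).
have -> : dot (enorm v ^+ 2 *: u - dot u v *: v)
              (enorm v ^+ 2 *: u - dot u v *: v) =
          enorm v ^+ 2 * ((enorm u * enorm v) ^+ 2 - dot u v ^+ 2).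
  rewrite !(dotBl, dotBr, dotZl, dotZr) (dotC v u) -!enorm_sqr; ring.
rewrite pmulr_rge0 ?exprn_gt0// subr_ge0 => uv.
apply: le_trans (ler_norm _) _.
by rewrite -(@ler_pXn2r _ 2)// ?nnegrE ?mulr_ge0 ?enorm_ge0// -normrX
  ger0_norm// sqr_ge0.
Qed.

Lemma enorm_sqrD u v :
  enorm (u + v) ^+ 2 = enorm u ^+ 2 + 2 * dot u v + enorm v ^+ 2.
Proof. rewrite !enorm_sqr !(dotDl, dotDr) (dotC v u); ring. Qed.

Lemma enormD u v : enorm (u + v) <= enorm u + enorm v.
Proof.
rewrite -(@ler_pXn2r _ 2)// ?nnegrE ?addr_ge0 ?enorm_ge0//.
by rewrite enorm_sqrD sqrrD lerD2r lerD2l mulr2n mulrDl !mul1r lerD// Cauchy_Schwarz.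
Qed.

Lemma enormB u v : enorm (u - v) <= enorm u + enorm v.
Proof. by rewrite (le_trans (enormD _ _))// enormN. Qed.

Lemma enorm_sum (I : finType) (F : I -> 'rV[R]_n) :
  enorm (\sum_i F i) <= \sum_i enorm (F i).
Proof.
elim/big_ind2 : _ => [|x1 x2 y1 y2 h1 h2|//]; first by rewrite enorm0.
by rewrite (le_trans (enormD _ _))// lerD.
Qed.

(** The topology on rows is the one of the sup norm; the two comparisons of
    norms allow limits and neighbourhoods to be handled with [enorm]. *)
Lemma norm_le_enorm u : `|u| <= enorm u.
Proof.
rewrite [leLHS]/Num.Def.normr/= mx_normrE.
apply: bigmax_le => [|[i j] _]; first exact: enorm_ge0.
by rewrite (ord1 i) coord_le_enorm.
Qed.

Lemma coord_le_norm u i : `|u 0 i| <= `|u|.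
Proof.
by rewrite [leRHS]/Num.Def.normr/= mx_normrE; apply/bigmax_geP; right => /=;
  exists (0, i).
Qed.

Lemma enorm_le_norm u : enorm u <= n%:R * `|u|.
Proof.
rewrite -[u in leLHS]mulmx1 mulmx_sum_row (le_trans (enorm_sum _))//.
have -> : n%:R * `|u| = \sum_(i < n) `|u| by rewrite sumr_const card_ord mulr_natl.
apply: ler_sum => i _.
rewrite enormZ; have -> : enorm (row i (1%:M : 'M[R]_n)) = 1.
  rewrite /enorm dotE rowE mulmx1 trmx_delta mul_delta_mx mxE eqxx.
  exact: sqrtr1.
by rewrite mulr1 coord_le_norm.
Qed.

Lemma enorm_cvg0 (T : Type) (F : set_system T) (FF : Filter F)
    (u_ : T -> 'rV[R]_n) u :
  (u_ x @[x --> F] --> u) -> enorm (u_ x - u) @[x --> F] --> (0 : R).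
Proof.
move=> /cvgrPdist_le u_u; apply/cvgr0Pnorm_le => e e0.
have ne : 0 < e / n.+1%:R by rewrite divr_gt0.
near=> x; rewrite ger0_norm ?enorm_ge0// (le_trans (enorm_le_norm _))//.
have : `|u - u_ x| <= e / n.+1%:R by near: x; exact: u_u.
rewrite distrC ler_pdivlMr// mulrC; apply: le_trans.
by rewrite ler_wpM2r// ler_nat.
Unshelve. all: by end_near. Qed.

Lemma cvg_enorm0 (T : Type) (F : set_system T) (FF : Filter F)
    (u_ : T -> 'rV[R]_n) u :
  (forall e, 0 < e -> \forall x \near F, enorm (u_ x - u) <= e) ->
  u_ x @[x --> F] --> u.
Proof.
move=> u_u; apply/cvgrPdist_le => e e0.
near=> x; rewrite distrC (le_trans (norm_le_enorm _))//.
by near: x; exact: u_u.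
Unshelve. all: by end_near. Qed.

Lemma near_enormP u (P : set 'rV[R]_n) :
  (\forall z \near u, P z) <->
  exists2 e, 0 < e & forall z, enorm (z - u) <= e -> P z.
Proof.
split=> [/nbhs_ballP[e /= e0 Pe]|[e e0 Pe]].
  exists (e / 2) => [|z zu]; first by rewrite divr_gt0.
  apply: Pe; rewrite -ball_normE/= distrC.
  by rewrite (le_lt_trans (norm_le_enorm _))// (le_lt_trans zu)//; lra.
have /cvgr0Pnorm_le : enorm (z - u) @[z --> u] --> (0 : R).
  by apply: (@enorm_cvg0 _ (nbhs u) _ id u); exact: cvg_id.
move=> /(_ _ e0); apply: filter_app; near=> z.
by rewrite ger0_norm ?enorm_ge0//; exact: Pe.
Unshelve. all: by end_near. Qed.

Lemma cvg_enorm (T : Type) (F : set_system T) (FF : Filter F)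
    (u_ : T -> 'rV[R]_n) u :
  (u_ x @[x --> F] --> u) -> enorm (u_ x) @[x --> F] --> enorm u.
Proof.
move=> /enorm_cvg0 /cvgr0Pnorm_le u_u; apply/cvgrPdist_le => e e0.
near=> x; have : `|enorm (u_ x - u)| <= e by near: x; exact: u_u.
rewrite ger0_norm ?enorm_ge0// => h.
have := enormD (u_ x - u) u; have := enormD (u - u_ x) (u_ x).
by rewrite !subrK (enormBC u) ler_norml; lra.
Unshelve. all: by end_near. Qed.

(** Sequential compactness of bounded sets.  The index map need not be
    increasing; that it tends to infinity is enough to compose limits. *)
Lemma bounded_subsequence (u_ : nat -> 'rV[R]_n) (M : R) :
  (forall k, enorm (u_ k) <= M) ->
  exists2 s : nat -> nat, (forall k, k <= s k)%N &
    exists u, u_ (s k) @[k --> \oo] --> u.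
Proof.
move=> u_M; pose A := [set u : 'rV[R]_n | `|u| <= M].
have cA : compact A.
  apply: bounded_closed_compact.
    by exists M; split; [exact: num_real|move=> x Mx y /= /le_trans; apply; exact: ltW].
  apply: (@closed_comp _ _ (fun u : 'rV[R]_n => `|u|) [set x | x <= M]).
    by move=> x _; exact: norm_continuous.
  exact: closed_le.
have [p [_ clp]] : A `&` cluster (u_ @ \oo) !=set0.
  apply: cA; exists 0%N => // k _.
  by rewrite /A/= (le_trans (norm_le_enorm _)).
have ex k : exists j, (k <= j)%N /\ `|u_ j - p| < k.+1%:R^-1.
  have [] := clp [set u_ j | j in [set j | (k <= j)%N]] (ball p k.+1%:R^-1).
  - by exists k => // j /= kj; exists j.
  - by apply: nbhsx_ballx; rewrite invr_gt0.
  - move=> _ [[j /= kj <-]]; rewrite -ball_normE/= distrC => ?.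
    by exists j.
have [s sP] := choice ex; exists s => [k|]; first by have [] := sP k.
exists p; apply/cvgrPdist_lt => e e0.
near=> k; rewrite distrC (lt_trans (sP k).2)//.
near: k; exact: near_infty_natSinv_lt (PosNum e0).
Unshelve. all: by end_near. Qed.

End Euclid.

Section SpectralNorm.
Variables (R : realType) (n : nat) (A : 'M[R]_n).

Let image_bounded : has_ubound
  [set enorm (u *m A) | u in [set u : 'rV[R]_n | enorm u <= 1]].
Proof.
exists (\sum_i enorm (row i A)) => _ [u /= u1 <-].
rewrite mulmx_sum_row (le_trans (enorm_sum _))//; apply: ler_sum => i _.
rewrite enormZ ler_piMl ?enorm_ge0//.
exact: le_trans (coord_le_enorm _ _) u1.
Qed.

Lemma spectral_norm_ge0 : 0 <= spectral_norm A.
Proof.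
apply: le_trans (enorm_ge0 (0 *m A)) _; apply: ub_le_sup => //.
by exists 0 => //=; rewrite enorm0.
Qed.

Lemma spectral_norm_le (u : 'rV[R]_n) :
  enorm (u *m A) <= spectral_norm A * enorm u.
Proof.
have [/enorm_eq0->|u0] := eqVneq (enorm u) 0.
  by rewrite mul0mx enorm0 mulr0.
have u_gt0 : 0 < enorm u by rewrite lt_def u0 enorm_ge0.
rewrite -ler_pdivrMr// mulrC -[X in X * _]gtr0_norm ?invr_gt0// -enormZ scalemxAl.
apply: ub_le_sup => //; eexists; last reflexivity.
by rewrite /= enormZ gtr0_norm ?invr_gt0// mulVf.
Qed.

End SpectralNorm.

(** * Subgradients and the proximal operator *)

Section Prox.
Variables (R : realType) (n : nat).
Implicit Types (h : 'rV[R]_n -> \bar R) (p x y z v : 'rV[R]_n).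

(** Finiteness of h p excludes h p = -oo, for which the inequality is void. *)
Definition subgradient h p v :=
  h p \is a fin_num /\ forall z, (h p + (dot v (z - p))%:E <= h z)%E.

Lemma subgradient_monotone h p p' v v' :
  subgradient h p v -> subgradient h p' v' -> 0 <= dot (v - v') (p - p').
Proof.
move=> [hp vP] [hp' v'P]; have := vP p'; have := v'P p.
rewrite -(fineK hp) -(fineK hp') -!EFinD !lee_fin dotBl -(opprB p' p) !dotNr; lra.
Qed.

(** Fermat's rule for a sum.  Along the segment from p to z, minimality bounds
    the decrease of h by the growth t (l + e) of psi, and convexity bounds
    h (p + t (z - p)) - h p by t (h z - h p); dividing by t, a single t for each
    e is enough. *)
Lemma argmin_sum_convex (psi : 'rV[R]_n -> R) h p z (l : R) :
  ext_convex h -> h z != -oo%E -> h p \is a fin_num ->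
  argmin (fun x => (psi x)%:E + h x)%E p ->
  (forall e, 0 < e -> exists t, 0 < t <= 1 /\
     psi (p + t *: (z - p)) <= psi p + t * (l + e)) ->
  (h p - l%:E <= h z)%E.
Proof.
move=> h_convex hz hp p_min psi_rate.
case hzE : (h z) hz => [b| |]// _; last exact: leey.
case hpE : (h p) hp => [a| |]// _.
rewrite -EFinB lee_fin; apply/ler_addgt0Pl => e e0.
have [t [/andP[t0 t1] psit]] := psi_rate e e0.
have wE : p + t *: (z - p) = t *: z + (1 - t) *: p.
  by rewrite scalerBr scalerBl scale1r addrCA addrA.
have := h_convex t z p; rewrite t1 ltW// => /(_ isT).
have := p_min (p + t *: (z - p)).
rewrite -wE hzE hpE -!EFinM -!EFinD; set w := p + _ in psit *.
case: (h w) => [c| |]//; rewrite -?EFinD !lee_fin// => psiw cw.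
have : t * a <= t * (b + (l + e)) by nra.
by rewrite ler_pM2l//; lra.
Qed.

Lemma argmin_subgradient (f : 'rV[R]_n -> R) h p :
  differentiable f p -> ext_convex h -> proper_efun h ->
  argmin (fun x => (f x)%:E + h x)%E p -> subgradient h p (- grad f p).
Proof.
move=> df h_convex [hNy [x0 hx0]] p_min.
have hp : h p \is a fin_num.
  rewrite fin_numE hNy/=; have := p_min x0; apply: contraTN => /eqP ->.
  by rewrite addey// -ltNge lte_add_pinfty// ltry.
split=> // z; rewrite dotNl EFinN.
apply: (argmin_sum_convex (psi := f)) => // e e0.
have -> : dot (grad f p) (z - p) = 'D_(z - p) f p.
  rewrite deriveE// [in RHS](row_sum_delta (z - p)) linear_sum/=.
  apply: eq_bigr => i _; rewrite linearZ/= mulrC [grad f p 0 i]mxE deriveE//.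
have /cvg_dnbhs_at_right/cvgrPdist_le := diff_derivable (v := z - p) df.
move=> /(_ e e0) near_e.
have : \forall t \near (0 : R)^'+, 0 < t <= 1 /\
    `|'D_(z - p) f p - t^-1 *: (f (t *: (z - p) + p) - f p)| <= e.
  near=> t; split; last first.
    near: t; exact: near_e.
  by apply/andP; split; near: t; [exact: nbhs_right_gt|apply: nbhs_right_le; exact: ltr01].
move=> /filter_ex[t [t01 tb]]; exists t; split=> //.
case/andP: t01 => t0 _; rewrite [p + _]addrC -lerBlDl -ler_pdivrMl//.
by move: tb; rewrite ler_norml => /andP[]; rewrite -[_ *: _]/(_ * _); lra.
Unshelve. all: by end_near. Qed.

Definition prox_objective (gamma : R) h y x : \bar R :=
  (gamma%:E * h x + (2^-1 * enorm (x - y) ^+ 2)%:E)%E.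

Variables (gamma : R) (h : 'rV[R]_n -> \bar R).
Hypotheses (gamma_gt0 : 0 < gamma) (h_proper : proper_efun h)
  (h_closed : lower_semicontinuous h) (h_convex : ext_convex h).

(** The subgradient is an affine minorant of h, hence the objective dominates a
    coercive quadratic and a minimizing sequence is bounded; lower
    semicontinuity makes its limit point a minimizer. *)
Lemma prox_exists x0 v y : subgradient h x0 v ->
  argmin (prox_objective gamma h y) !=set0.
Proof.
move=> [hx0 vP]; have hNy := h_proper.1.
pose c := gamma * (fine (h x0) + dot v (y - x0)) - gamma ^+ 2 * dot v v.
have obj_ge z : ((c + 4^-1 * enorm (z - y) ^+ 2)%:E <=
                 prox_objective gamma h y z)%E.
  have := vP z; rewrite /prox_objective -(fineK hx0) -EFinD.
  case: (h z) (hNy z) => [r| |]// _; last first.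
    by rewrite gt0_muley ?lte_fin// addye// => _; exact: leey.
  rewrite -EFinM -EFinD !lee_fin -(subrKA y z) [dot v (_ + (y - _))]dotDr.
  move: (z - y) => d hr.
  (* Young: gamma <v, z - y> >= - |gamma v|^2 - |z - y|^2 / 4 *)
  have := dot_ge0 (gamma *: v + 2^-1 *: d).
  rewrite !(dotDl, dotDr, dotZl, dotZr) (dotC d v) -!enorm_sqr.
  have := ler_wpM2l (ltW gamma_gt0) hr; rewrite /c -enorm_sqr; lra.
pose I := ereal_inf (range (prox_objective gamma h y)).
have I_le z : (I <= prox_objective gamma h y z)%E.
  by apply: ereal_inf_lbound; exists z.
have I_fin : I \is a fin_num.
  rewrite fin_numElt; apply/andP; split.
    apply: (@lt_le_trans _ _ c%:E); first exact: ltNyr.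
    apply: le_ereal_inf_tmp => _ [z _ <-]; apply: le_trans (obj_ge z).
    by rewrite lee_fin lerDl mulr_ge0// sqr_ge0.
  apply: le_lt_trans (I_le x0) _.
  by rewrite /prox_objective -(fineK hx0) -EFinM -EFinD ltry.
have ex k : exists z,
    (prox_objective gamma h y z < (fine I + k.+1%:R^-1)%:E)%E.
  have [|_ [z _ <-]] := @lb_ereal_inf_adherent _
    (range (prox_objective gamma h y)) k.+1%:R^-1 _ I_fin.
    by rewrite invr_gt0.
  by rewrite -/I => ?; exists z; rewrite EFinD fineK.
have [z_ z_min] := choice ex.
have z_bnd k : enorm (z_ k - y) <= 4 * (fine I + 1 - c) + 1.
  have := le_lt_trans (obj_ge (z_ k)) (z_min k); rewrite lte_fin => zk.
  have k1 : k.+1%:R^-1 <= 1 :> R by rewrite invf_le1// ler1n.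
  move: zk k1; move: (enorm _) (k.+1%:R^-1) => N q zk q1.
  by have := sqr_ge0 (N - 1); have := sqr_ge0 N; lra.
have [|s s_ge [p z_p]] := @bounded_subsequence _ _ z_
  (4 * (fine I + 1 - c) + 1 + enorm y).
  move=> k.
  by rewrite -{1}(subrK y (z_ k)) (le_trans (enormD _ _))// lerD2r.
exists p => z; apply: le_trans (I_le z); rewrite leNgt; apply/negP => I_lt.
have [b b_lt b_gt] : exists2 b, (b%:E < h p)%E &
    fine I < gamma * b + 2^-1 * enorm (p - y) ^+ 2.
  move: I_lt; rewrite -(fineK I_fin) /prox_objective.
  case: (h p) (hNy p) => [r| |]// _.
    rewrite -EFinM -EFinD lte_fin => I_lt.
    pose d := gamma * r + 2^-1 * enorm (p - y) ^+ 2 - fine I.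
    exists (r - d / (2 * gamma)).
      by rewrite lte_fin ltrBlDr ltrDl divr_gt0 ?mulr_gt0// subr_gt0.
    have -> : gamma * (r - d / (2 * gamma)) = gamma * r - d / 2.
      by field; rewrite gt_eqF.
    rewrite /d; lra.
  move=> _; exists ((fine I - 2^-1 * enorm (p - y) ^+ 2 + 1) / gamma).
    by rewrite ltry.
  by rewrite mulrC divfK ?gt_eqF//; lra.
have [V pV Vb] := h_closed b_lt.
(* the strict lower bound b of h p persists along the sequence and contradicts
   the convergence of the objective to its infimum *)
suff : gamma * b + 2^-1 * enorm (p - y) ^+ 2 <= fine I + 0 by lra.
have zy : enorm (z_ (s k) - y) @[k --> \oo] --> enorm (p - y).
  apply: (@cvg_enorm _ _ _ \oo _ (fun k => z_ (s k) - y)).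
  by apply: cvgB => //; exact: cvg_cst.
apply: (@ler_cvg_to _ \oo _ _ (fun k => gamma * b + 2^-1 * enorm (z_ (s k) - y) ^+ 2)
   (fun k => fine I + k.+1%:R^-1)).
- apply: cvgD; first exact: cvg_cst.
  apply: cvgM; first exact: cvg_cst.
  exact: cvgM.
- apply: cvgD; first exact: cvg_cst.
  exact: cvg_harmonic.
- have : \forall k \near \oo, V (z_ (s k)) by exact: z_p.
  apply: filterS => k /Vb b_lt_k; have := z_min (s k).
  rewrite /prox_objective; case: (h _) b_lt_k (hNy (z_ (s k))) => [r| |]// + _.
    rewrite -EFinM -EFinD !lte_fin => br.
    have : gamma * b < gamma * r by rewrite ltr_pM2l.
    have : (s k).+1%:R^-1 <= k.+1%:R^-1 :> R.
      by rewrite lef_pV2 ?posrE// ler_nat ltnS.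
    by move: ((s k).+1%:R^-1) (k.+1%:R^-1) => q q'; lra.
  by rewrite gt0_muley ?lte_fin// addye.
Qed.

Lemma prox_argmin x0 v y : subgradient h x0 v ->
  argmin (prox_objective gamma h y) (prox gamma h y).
Proof. by move=> /(prox_exists y) [p pP]; exact: (xgetPex 0 (ex_intro _ p pP)). Qed.

(** Fermat's rule, with the quadratic term of the objective as the smooth
    summand. *)
Lemma prox_subgradient x0 v y : subgradient h x0 v ->
  subgradient h (prox gamma h y) (gamma^-1 *: (y - prox gamma h y)).
Proof.
move=> vP; have := prox_argmin y vP; set p := prox _ _ _ => p_min.
have hNy := h_proper.1.
have hp : h p \is a fin_num.
  rewrite fin_numE hNy/=; have := p_min x0; apply: contraTN => /eqP hp.
  rewrite /prox_objective hp gt0_muley ?lte_fin// addye// -(fineK vP.1).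
  by rewrite -EFinM -EFinD -ltNge ltry.
split=> // z.
have -> : dot (gamma^-1 *: (y - p)) (z - p) = - (gamma^-1 * dot (p - y) (z - p)).
  by rewrite dotZl -(opprB p y) dotNl mulrN.
rewrite EFinN.
apply: (argmin_sum_convex (psi := fun x => gamma^-1 * (2^-1 * enorm (x - y) ^+ 2))) => //.
- move=> x; have := p_min x; rewrite /prox_objective.
  rewrite -(fineK hp); case: (h x) (hNy x) => [r| |]// _; last by rewrite addey// leey.
  rewrite -!EFinM -!EFinD !lee_fin => px.
  rewrite -(ler_pM2l gamma_gt0) !mulrDr !mulVKf ?gt_eqF//; lra.
move=> e e0; pose N := dot (z - p) (z - p).
have N0 : 0 <= N := dot_ge0 _.
(* small enough for the second-order term t^2 N to be at most t gamma e *)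
exists (gamma * e / (gamma * e + N + 1)); set t := _ / _.
have ge0 : 0 < gamma * e by rewrite mulr_gt0.
have D0 : 0 < gamma * e + N + 1 by lra.
have t0 : 0 < t by rewrite divr_gt0.
split; first by rewrite t0 ler_pdivrMr// mul1r; lra.
have -> : enorm (p + t *: (z - p) - y) ^+ 2 =
    enorm (p - y) ^+ 2 + 2 * t * dot (p - y) (z - p) + t ^+ 2 * N.
  rewrite [in LHS]addrAC [LHS]enorm_sqrD dotZr enormZ exprMn real_normK ?num_real//.
  by rewrite (enorm_sqr (z - p)) mulrA.
have tN : t * N <= gamma * e.
  rewrite /t -mulrA ger_pMr// mulrC ler_pdivrMr// mul1r; lra.
have -> : t * (gamma^-1 * dot (p - y) (z - p) + e) =
  gamma^-1 * (t * dot (p - y) (z - p) + t * (gamma * e)).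
  by field; rewrite gt_eqF.
rewrite -mulrDr ler_pM2l ?invr_gt0//.
have := ler_wpM2l (ltW t0) tN; have tN0 : 0 <= t * N by rewrite mulr_ge0// ltW.
have := mulr_ge0 (ltW t0) tN0; rewrite expr2; lra.
Qed.

Lemma prox_unique x v : subgradient h x v ->
  forall y, v = gamma^-1 *: (y - x) -> prox gamma h y = x.
Proof.
move=> vP y vE; have := subgradient_monotone (prox_subgradient y vP) vP.
rewrite vE; set p := prox _ _ _.
rewrite -scalerBr dotZl pmulr_rge0 ?invr_gt0//.
have -> : y - p - (y - x) = - (p - x) by rewrite opprB addrC addrA subrK opprB.
rewrite dotNl oppr_ge0 => px0; apply/subr0_eq/enorm_eq0/eqP.
by rewrite /enorm sqrtr_eq0.
Qed.

Lemma prox_nonexpansive x0 v y y' : subgradient h x0 v ->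
  enorm (prox gamma h y - prox gamma h y') <= enorm (y - y').
Proof.
move=> vP; have := subgradient_monotone (prox_subgradient y vP) (prox_subgradient y' vP).
set p := prox _ _ y; set p' := prox _ _ y'.
rewrite -scalerBr dotZl pmulr_rge0 ?invr_gt0//.
have -> : y - p - (y' - p') = (y - y') - (p - p').
  by rewrite !opprB addrACA [RHS]addrACA; congr (_ + _); rewrite addrC.
rewrite dotBl subr_ge0 -enorm_sqr expr2 => pp'.
have := le_trans pp' (Cauchy_Schwarz _ _).
have [->|p0] := eqVneq (enorm (p - p')) 0; first by rewrite enorm_ge0.
by rewrite ler_pM2r// lt_def p0 enorm_ge0.
Qed.

End Prox.

(** * Differentiability in terms of the Euclidean norm *)

Section EuclideanDiff.
Variables (R : realType) (n : nat).
Implicit Types (f : 'rV[R]_n -> 'rV[R]_n) (p z : 'rV[R]_n) (A : 'M[R]_n).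

(** Frechet differentiability at p with Jacobian A, in the Euclidean norm; with
    explicit radii it composes with estimates on the iterates. *)
Definition linear_approx f p A := forall e, 0 < e -> exists2 d, 0 < d &
  forall z, enorm (z - p) <= d ->
    enorm (f z - f p - (z - p) *m A) <= e * enorm (z - p).

Lemma mulmxr_continuous A : continuous (mulmxr A : 'rV[R]_n -> 'rV[R]_n).
Proof.
move=> u; apply: (@cvg_enorm0 _ _ _ (nbhs u) (nbhs_filter u)) => e e0.
have s0 : 0 < spectral_norm A + 1.
  by rewrite (le_lt_trans (spectral_norm_ge0 A))// ltrDl.
apply/near_enormP; exists (e / (spectral_norm A + 1)) => [|z].
  by rewrite divr_gt0.
rewrite ler_pdivlMr// /= -mulmxBl => zu.
apply: le_trans (spectral_norm_le _ _) _; apply: le_trans zu.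
by rewrite mulrC ler_wpM2l ?enorm_ge0// lerDl.
Qed.

Lemma linear_approx_differentiable f p A :
  linear_approx f p A -> differentiable f p.
Proof.
move=> fA.
have fo : f \o shift p = cst (f p) + (mulmxr A : 'rV[R]_n -> 'rV[R]_n) +o_ (0 : 'rV[R]_n) id.
  apply/eqaddoP => e e0.
  have ne : 0 < e / n.+1%:R by rewrite divr_gt0.
  have [d d0 fd] := fA _ ne.
  apply/near_enormP; exists d => // u; rewrite subr0 => ud.
  have := fd (u + p); rewrite addrK => /(_ ud) fu.
  rewrite !fctE /= opprD addrA.
  apply: le_trans (norm_le_enorm _) _; apply: le_trans fu _.
  apply: le_trans (ler_wpM2l (ltW ne) (enorm_le_norm _)) _.
  rewrite mulrA ler_wpM2r// -mulrA ger_pMr// mulrC ler_pdivrMr// mul1r.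
  by rewrite ler_nat.
apply/diff_locallyP; rewrite (diff_unique (@mulmxr_continuous A) fo).
by split=> //; exact: mulmxr_continuous.
Qed.

Lemma differentiable_linear_approx f p :
  differentiable f p -> linear_approx f p ('J f p).
Proof.
move=> df e e0; have /diff_locallyP[_ /eqaddoP fo] := df.
have ne : 0 < e / n.+1%:R by rewrite divr_gt0.
have /near_enormP[d d0 fd] := fo _ ne.
exists d => // z zp; have := fd (z - p); rewrite subr0 => /(_ zp).
rewrite !fctE /= subrK opprD addrA.
have -> : 'd f p (z - p) = (z - p) *m 'J f p by rewrite mul_rV_lin1.
move=> fz; apply: le_trans (enorm_le_norm _) _.
apply: le_trans (ler_wpM2l _ fz) _; first exact: ler0n.
rewrite mulrA; apply: ler_pM; rewrite ?normr_ge0 ?norm_le_enorm//.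
  by rewrite mulr_ge0 ?ler0n// ltW.
by rewrite mulrCA ger_pMr// ler_pdivrMr// mul1r ler_nat.
Qed.

End EuclideanDiff.

(** * Second-order epi-derivatives and the derivative of the proximal operator *)

Section LimSup.
Variable R : realType.
Implicit Types (u : nat -> \bar R) (a b e : R).

Lemma limn_esup_near_lt u a b :
  (limn_esup u <= a%:E)%E -> a < b -> \forall k \near \oo, (u k < b%:E)%E.
Proof.
move=> ua ab.
have /ereal_inf_lt[_ [V NV <-] Vb] : (limn_esup u < b%:E)%E.
  by rewrite (le_lt_trans ua)// lte_fin.
apply: filterS NV => k Vk; apply: le_lt_trans Vb.
by apply: ereal_sup_ubound; exists k.
Qed.

Lemma limn_einf_near_gt u b :
  (b%:E < limn_einf u)%E -> \forall k \near \oo, (b%:E < u k)%E.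
Proof.
rewrite /limn_einf lteNr => /ereal_inf_lt[_ [V NV <-] Vb].
apply: filterS NV => k Vk; rewrite -lteN2; apply: le_lt_trans Vb.
by apply: ereal_sup_ubound; exists k.
Qed.

Lemma limn_esup_le u a :
  (forall b, a < b -> \forall k \near \oo, (u k <= b%:E)%E) ->
  (limn_esup u <= a%:E)%E.
Proof.
move=> uP; apply/lee_addgt0Pr => e e0.
have /uP ue : a < a + e by rewrite ltrDl.
apply: ge_ereal_inf; eexists; first by exists [set k | (u k <= (a + e)%:E)%E].
by apply: ge_ereal_sup => _ [k /= uk <-].
Qed.

End LimSup.

(** The proximal problem of the quadratic form c <w, w Q> / 2 on the subspace S.
    The stationarity condition says that c p Q + p - xi is orthogonal to S. *)
Section QuadraticProx.
Variables (R : realType) (n : nat) (S : {vspace 'rV[R]_n}) (Q : 'M[R]_n).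
Variable c : R.
Hypothesis c_ge0 : 0 <= c.
Hypothesis Q_psd : forall w : 'rV[R]_n, w \in S -> 0 <= dot w (w *m Q).

(** With the rows of B a basis of S, the minimizer is a B where a solves the
    normal equations a (B (c Q + 1) B^T) = xi B^T; their matrix is positive
    definite because Q is nonnegative on S. *)
Lemma quadratic_prox_matrix : exists P : 'M[R]_n, forall xi : 'rV[R]_n,
  xi *m P \in S /\ forall d, d \in S ->
    dot d (c *: (xi *m P *m Q) + xi *m P - xi) = 0.
Proof.
pose B := \matrix_(i < \dim S) (vbasis S)`_i.
have BS (a : 'rV_(\dim S)) : a *m B \in S.
  rewrite mulmx_sum_row; apply: memv_suml => i _; apply: memvZ.
  by rewrite rowK vbasis_mem// mem_nth// size_tuple.
have B_onto d : d \in S -> exists a : 'rV_(\dim S), d = a *m B.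
  move=> dS; exists (\row_i coord (vbasis S) i d).
  rewrite {1}(coord_vbasis dS) mulmx_sum_row.
  by apply: eq_bigr => i _; rewrite mxE rowK.
pose N := c *: Q + 1%:M.
have N_pos w : w \in S -> dot w (w *m N) = 0 -> w = 0.
  move=> wS; rewrite mulmxDr mulmx1 -scalemxAr dotDr dotZr => w0.
  apply: enorm_eq0; apply/eqP; rewrite /enorm sqrtr_eq0.
  by have := mulr_ge0 c_ge0 (Q_psd wS); lra.
have M_unit : B *m N *m B^T \in unitmx.
  rewrite -row_free_unit; apply: inj_row_free => a a0.
  have : a *m B = 0.
    apply: N_pos => //; rewrite dotC dotE trmx_mul.
    by rewrite !mulmxA in a0 *; rewrite a0 mul0mx mxE.
  rewrite mulmx_sum_row => aB.
  apply/rowP => i; rewrite mxE.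
  have /freeP/(_ (fun i => a 0 i)) := basis_free (vbasisP S).
  apply; rewrite -[RHS]aB; apply: eq_bigr => j _; by rewrite rowK.
exists (B^T *m invmx (B *m N *m B^T) *m B) => xi.
set P := _ *m B; split; first by rewrite mulmxA BS.
move=> d /B_onto[a ->].
have -> : c *: (xi *m P *m Q) + xi *m P - xi = xi *m P *m N - xi.
  by rewrite mulmxDr mulmx1 -scalemxAr.
rewrite dotC dotE mulmxBl trmx_mul /P !mulmxA.
rewrite -(mulmxA _ B N) -(mulmxA _ (B *m N)) -(mulmxA _ (invmx _)).
by rewrite mulVmx// mulmx1 subrr mxE.
Qed.

(** The quadratic excess |w - p|^2 makes the minimizer unique. *)
Lemma quadratic_prox_growth (p xi w : 'rV[R]_n) : Q^T = Q ->
  p \in S -> w \in S ->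
  (forall d, d \in S -> dot d (c *: (p *m Q) + p - xi) = 0) ->
  c * dot p (p *m Q) + enorm (p - xi) ^+ 2 + enorm (w - p) ^+ 2 <=
  c * dot w (w *m Q) + enorm (w - xi) ^+ 2.
Proof.
move=> Q_sym pS wS p_opt.
have dS : w - p \in S by rewrite memvB.
have := p_opt _ dS; rewrite -addrA dotDr dotZr; have := mulr_ge0 c_ge0 (Q_psd dS).
have -> : w - xi = (w - p) + (p - xi) by rewrite subrKA.
have -> : dot w (w *m Q) = dot p (p *m Q) + 2 * dot (w - p) (p *m Q) +
                           dot (w - p) ((w - p) *m Q).
  rewrite -{1 2}(subrK p w); move: (w - p) => d.
  by rewrite mulmxDl dotDr !dotDl (dotC p (d *m Q)) dot_mulmxl Q_sym; ring.
rewrite (enorm_sqrD (w - p)); lra.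
Qed.

End QuadraticProx.

Section SecondOrderQuotient.
Variables (R : realType) (n : nat) (h : 'rV[R]_n -> \bar R) (x v : 'rV[R]_n).
Hypothesis xv : subgradient h x v.

Lemma quotient2_ge0 t xi : 0 < t -> (0 <= quotient2 h x v t xi)%E.
Proof.
move=> t0; apply: mule_ge0.
  by rewrite lee_fin invr_ge0 divr_ge0// sqr_ge0.
have [hx /(_ (x + t *: xi))] := xv.
rewrite [_ + _ - x]addrC addKr dotZr.
case: (h x) hx => [a| |]// _; case: (h (x + t *: xi)) => [r| |]//.
  by rewrite -EFinD -!EFinB !lee_fin; lra.
by move=> _; rewrite addye.
Qed.

(** Second-order quotients at a subgradient are nonnegative; a recovery sequence
    passes this on to the epi-limit. *)
Lemma generalized_quadratic_psd S Q :
  is_second_epi_derivative h x v (generalized_quadratic S Q) ->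
  forall w, w \in S -> 0 <= dot w (w *m Q).
Proof.
move=> [_ epi] w wS.
have [|_ [u_ _]] := epi (fun k => k.+1%:R^-1) _ (@cvg_harmonic R) w.
  by move=> k; rewrite invr_gt0.
rewrite /generalized_quadratic wS => u_w.
rewrite -(pmulr_rge0 _ (_ : 0 < 2^-1)) ?invr_gt0//.
rewrite leNgt; apply/negP => /(limn_esup_near_lt u_w) [N _ /(_ N (leqnn N))] /=.
by rewrite ltNge quotient2_ge0// invr_gt0.
Qed.

End SecondOrderQuotient.

Section ProxDerivative.
Variables (R : realType) (n : nat) (h : 'rV[R]_n -> \bar R) (x v : 'rV[R]_n).
Variable gamma : R.
Hypotheses (gamma_gt0 : 0 < gamma) (h_proper : proper_efun h)
  (h_closed : lower_semicontinuous h) (h_convex : ext_convex h)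
  (xv : subgradient h x v).

Let px := prox gamma h.
Let y : 'rV[R]_n := x + gamma *: v.
Let px_quotient (t : R) (xi : 'rV[R]_n) : 'rV[R]_n := t^-1 *: (px (y + t *: xi) - x).

Let px_y : px y = x.
Proof.
apply: (prox_unique gamma_gt0 h_proper h_closed h_convex xv).
by rewrite /y addrAC subrr add0r scalerA mulVf ?gt_eqF// scale1r.
Qed.

(** The substitution p = x + t w turns the proximal objective at y + t xi into
    t^2 times (gamma / 2) quotient2 + |w - xi|^2 / 2, up to a constant: the terms
    linear in w cancel since y - x = gamma v.  Real bounds b and r stand for the
    two quotients because epi-convergence bounds one from below and the other
    from above, and r need only exist for some competitors u. *)
Lemma prox_quotient_min t xi u r b : 0 < t ->
  (b%:E <= quotient2 h x v t (px_quotient t xi))%E ->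
  (quotient2 h x v t u <= r%:E)%E ->
  gamma / 2 * b + 2^-1 * enorm (px_quotient t xi - xi) ^+ 2 <=
  gamma / 2 * r + 2^-1 * enorm (u - xi) ^+ 2.
Proof.
move=> t0; set w := px_quotient t xi.
have pE : px (y + t *: xi) = x + t *: w.
  by rewrite /w /px_quotient scalerA mulfV ?gt_eqF// scale1r [RHS]addrC subrK.
clearbody w.
have [] := prox_subgradient gamma_gt0 h_proper h_closed h_convex (y + t *: xi) xv.
have := prox_argmin gamma_gt0 h_proper h_closed (y + t *: xi) xv.
rewrite -/px pE => /(_ (x + t *: u)) + + _.
have sqE z : enorm (x + t *: z - (y + t *: xi)) ^+ 2 =
    t ^+ 2 * enorm (z - xi) ^+ 2 - 2 * t * gamma * dot v z
    + 2 * t * gamma * dot v xi + gamma ^+ 2 * enorm v ^+ 2.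
  have -> : x + t *: z - (y + t *: xi) = t *: (z - xi) + (- gamma) *: v.
    by apply/rowP => i; rewrite !mxE; ring.
  rewrite enorm_sqrD !enormZ !exprMn !real_normK ?num_real// sqrrN.
  by rewrite dotZl dotZr dotBl !(dotC _ v); ring.
rewrite /prox_objective /quotient2 !sqE => + hw.
have hx := xv.1.
have q0 : (0 < (t ^+ 2 / 2)^-1) by rewrite invr_gt0 divr_gt0// exprn_gt0.
case: (h x) hx => [a| |]// _; case: (h (x + t *: w)) hw => [s'| |]// _.
case: (h (x + t *: u)) (h_proper.1 (x + t *: u)) => [s| |]// _; last first.
  by move=> _ _; rewrite gt0_muley ?lte_fin.
rewrite -!EFinB -!EFinM -!EFinD !lee_fin => obj.
rewrite ler_pdivlMl ?divr_gt0 ?exprn_gt0// ler_pdivrMl ?divr_gt0 ?exprn_gt0//.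
move=> /(ler_wpM2l (ltW gamma_gt0)) bw /(ler_wpM2l (ltW gamma_gt0)) ur.
have t20 : 0 < t ^+ 2 by rewrite exprn_gt0.
by rewrite -(ler_pM2l t20); lra.
Qed.

(** The quotients are compared with a recovery sequence of the minimizer
    p = xi P of the limiting problem.  The liminf half of epi-convergence at w
    and the limsup half at p make w a minimizer too, hence w = p. *)
Lemma prox_quotient_limit S Q P (t : nat -> R) (xi_ : nat -> 'rV[R]_n)
    (xi w : 'rV[R]_n) :
  Q^T = Q -> is_second_epi_derivative h x v (generalized_quadratic S Q) ->
  (forall xi, xi *m P \in S /\ forall d, d \in S ->
    dot d (gamma / 2 *: (xi *m P *m Q) + xi *m P - xi) = 0) ->
  (forall k, 0 < t k) -> t @ \oo --> (0 : R) ->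
  xi_ @ \oo --> xi -> px_quotient (t k) (xi_ k) @[k --> \oo] --> w ->
  w = xi *m P.
Proof.
move=> Q_sym h_epi PP t0 t_0 xi_xi w_w.
have [pS p_opt] := PP xi; move: (xi *m P) pS p_opt => p pS p_opt.
have Q_psd := generalized_quadratic_psd xv h_epi.
have [_ [u_ u_p]] := h_epi.2 t t0 t_0 p.
rewrite /generalized_quadratic pS => u_limsup.
have [w_liminf _] := h_epi.2 t t0 t_0 w.
have {}w_liminf := w_liminf _ w_w.
have min_lim b e : (b%:E < generalized_quadratic S Q w)%E -> 0 < e ->
    gamma / 2 * b + 2^-1 * enorm (w - xi) ^+ 2 <=
    gamma / 2 * (2^-1 * dot p (p *m Q) + e) + 2^-1 * enorm (p - xi) ^+ 2.
  move=> bw e0.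
  have near_b := limn_einf_near_gt (lt_le_trans bw w_liminf).
  have near_u := limn_esup_near_lt u_limsup (_ : _ < _ + e).
  apply: (@ler_cvg_to _ \oo _ _
    (fun k => gamma / 2 * b + 2^-1 * enorm (px_quotient (t k) (xi_ k) - xi_ k) ^+ 2)
    (fun k => gamma / 2 * (2^-1 * dot p (p *m Q) + e) + 2^-1 * enorm (u_ k - xi_ k) ^+ 2)).
  - apply: cvgD; first exact: cvg_cst.
    apply: cvgM; first exact: cvg_cst.
    by apply: cvgM; apply: (@cvg_enorm _ _ _ \oo); exact: cvgB.
  - apply: cvgD; first exact: cvg_cst.
    apply: cvgM; first exact: cvg_cst.
    by apply: cvgM; apply: (@cvg_enorm _ _ _ \oo); exact: cvgB.
  - near=> k; apply: prox_quotient_min => //.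
      by apply: ltW; near: k; exact: near_b.
    by apply: ltW; near: k; apply: near_u; rewrite ltrDl.
(* outside S the epi-derivative is +oo, and every b would be admissible *)
have wS : w \in S.
  apply/negPn/negP => /negbTE wS.
  pose b := (gamma / 2 * (2^-1 * dot p (p *m Q) + 1) +
    2^-1 * enorm (p - xi) ^+ 2 + 1) / (gamma / 2).
  have := min_lim b 1; rewrite /generalized_quadratic wS ltry => /(_ isT ltr01).
  rewrite [_ * b]mulrC divfK; last by rewrite gt_eqF// divr_gt0.
  by have := sqr_ge0 (enorm (w - xi)); lra.
have := quadratic_prox_growth (ltW (divr_gt0 gamma_gt0 (ltr0n _ 2))) Q_psd Q_sym pS wS p_opt.
suff : gamma / 2 * dot w (w *m Q) + enorm (w - xi) ^+ 2 <=
       gamma / 2 * dot p (p *m Q) + enorm (p - xi) ^+ 2.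
  move=> le1 le2; apply/subr0_eq/enorm_eq0/eqP; rewrite -sqrf_eq0.
  by rewrite eq_le sqr_ge0 andbT; lra.
apply/ler_addgt0Pl => e e0.
have eg0 : 0 < e / (2 * gamma) by rewrite divr_gt0// mulr_gt0.
have := min_lim (2^-1 * dot w (w *m Q) - e / (2 * gamma)) (e / (2 * gamma)).
rewrite /generalized_quadratic wS lte_fin ltrBlDr ltrDl eg0 => /(_ isT isT).
have : gamma / 2 * (e / (2 * gamma)) = e / 4.
  by field; rewrite gt_eqF.
rewrite mulrBr mulrDr => ->; lra.
Unshelve. all: by end_near. Qed.

(** A failure of the linear approximation would give points z k converging to y
    with a relative error above e.  Directions and difference quotients are
    bounded, the latter because prox is nonexpansive, so that along a
    subsequence both converge, to limits related by P. *)
Lemma prox_differentiable S Q :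
  Q^T = Q -> is_second_epi_derivative h x v (generalized_quadratic S Q) ->
  differentiable px y.
Proof.
move=> Q_sym h_epi.
have [P PP] := quadratic_prox_matrix (ltW (divr_gt0 gamma_gt0 (ltr0n _ 2)))
  (generalized_quadratic_psd xv h_epi).
apply: (@linear_approx_differentiable _ _ _ _ P) => e e0.
apply: contrapT => no_d.
have ex k : exists z, enorm (z - y) <= k.+1%:R^-1 /\
    e * enorm (z - y) < enorm (px z - px y - (z - y) *m P).
  apply: contrapT => no_z; apply: no_d; exists k.+1%:R^-1.
    by rewrite invr_gt0.
  by move=> z zy; rewrite leNgt; apply/negP => ?; apply: no_z; exists z.
have [z zP] := choice ex.
pose t k := enorm (z k - y).
have t0 k : 0 < t k.
  rewrite lt_def enorm_ge0 andbT; apply/negP => /eqP zy.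
  have := (zP k).2; rewrite -/(t k) zy mulr0 (enorm_eq0 zy) mul0mx subr0.
  by rewrite (subr0_eq (enorm_eq0 zy)) subrr enorm0 ltxx.
have t_cvg0 (s : nat -> nat) : (forall k, k <= s k)%N -> t (s k) @[k --> \oo] --> (0 : R).
  move=> s_ge; apply: (@squeeze_cvgr _ \oo _ _ (fun=> 0) (fun k => k.+1%:R^-1)).
  - near=> k; rewrite enorm_ge0/=; apply: le_trans (zP (s k)).1 _.
    by rewrite lef_pV2 ?posrE// ler_nat ltnS.
  - exact: cvg_cst.
  - exact: cvg_harmonic.
pose xi_ k := (t k)^-1 *: (z k - y).
have zE k : y + t k *: xi_ k = z k.
  by rewrite scalerA mulfV ?gt_eqF// scale1r addrC subrK.
pose w_ k := px_quotient (t k) (xi_ k).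
have [|s s_ge [xi xi_xi]] := @bounded_subsequence _ _ xi_ 1.
  by move=> k; rewrite enormZ gtr0_norm ?invr_gt0// mulVf// gt_eqF.
have [|s' s'_ge [w w_w]] := @bounded_subsequence _ _ (w_ \o s) 1.
  move=> k /=; rewrite enormZ gtr0_norm ?invr_gt0// ler_pdivrMl// mulr1 zE -px_y.
  exact: (prox_nonexpansive gamma_gt0 h_proper h_closed h_convex _ _ xv).
have ss'_ge k : (k <= s (s' k))%N := leq_trans (s'_ge k) (s_ge _).
have xi_xi' : xi_ (s (s' k)) @[k --> \oo] --> xi.
  apply: (@cvg_comp _ _ _ s' (xi_ \o s) \oo \oo) => //.
  by apply/cvgnyPge => N; exists N => // k /= Nk; rewrite (leq_trans Nk).
have wE : w = xi *m P.
  apply: (prox_quotient_limit Q_sym h_epi PP _ (t_cvg0 _ ss'_ge) xi_xi' w_w) => k.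
  exact: t0.
suff : e <= enorm (w - xi *m P) by rewrite wE subrr enorm0 leNgt e0.
apply: (@ler_cvg_to _ \oo _ _ (fun=> e)
  (fun k => enorm (w_ (s (s' k)) - xi_ (s (s' k)) *m P))).
- exact: cvg_cst.
- apply: (@cvg_enorm _ _ _ \oo); apply: cvgB => //.
  exact: (cvg_comp _ _ xi_xi' (@mulmxr_continuous _ _ P xi)).
- near=> k; have := (zP (s (s' k))).2; move: (s (s' k)) => j.
  have -> : px (z j) - px y - (z j - y) *m P = t j *: (w_ j - xi_ j *m P).
    rewrite /w_ /px_quotient zE px_y scalerBr scalemxAl !scalerA.
    by rewrite mulfV ?gt_eqF// !scale1r.
  by rewrite -/(t j) enormZ gtr0_norm// mulrC ltr_pM2l// => /ltW.
Unshelve. all: by end_near. Qed.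

End ProxDerivative.

(** * Residuals of affine mixtures of fixed-point iterates *)

Section MixingStep.
Variables (R : realType) (n : nat) (g : 'rV[R]_n -> 'rV[R]_n) (ys : 'rV[R]_n).
Variables (A : 'M[R]_n) (e d : R).
Let rho := spectral_norm A.
Let F z := g z - z.
Hypothesis e_ge0 : 0 <= e.
Hypothesis g_approx : forall z, enorm (z - ys) <= d ->
  enorm (g z - ys - (z - ys) *m A) <= e * enorm (z - ys).

Lemma image_dist_le z : enorm (z - ys) <= d ->
  enorm (g z - ys) <= (rho + e) * enorm (z - ys).
Proof.
move=> /g_approx gz; have := enormD (g z - ys - (z - ys) *m A) ((z - ys) *m A).
by rewrite subrK mulrDl; have := spectral_norm_le A (z - ys); rewrite -/rho; lra.
Qed.

Lemma residual_le_dist z : enorm (z - ys) <= d ->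
  enorm (F z) <= (1 + rho + e) * enorm (z - ys).
Proof.
move=> /image_dist_le gz; have -> : F z = (g z - ys) - (z - ys).
  by rewrite /F opprB addrA subrK.
by apply: le_trans (enormB _ _) _; lra.
Qed.

Lemma dist_le_residual z : enorm (z - ys) <= d ->
  (1 - rho - e) * enorm (z - ys) <= enorm (F z).
Proof.
move=> /image_dist_le gz; have := enormB (g z - ys) (F z).
have -> : g z - ys - F z = z - ys by rewrite /F opprB addrC subrKA.
by lra.
Qed.

Variables (I : finType) (a : I -> R) (z : I -> 'rV[R]_n) (M D : R).
Hypotheses (a_sum : \sum_i a i = 1) (a_norm : \sum_i `|a i| <= M).
Hypotheses (zd : forall i, enorm (z i - ys) <= d)
  (zD : forall i, enorm (z i - ys) <= D).
Let y' := \sum_i a i *: g (z i).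

Let mixture_le (G : I -> 'rV[R]_n) (b : R) : 0 <= b ->
  (forall i, enorm (G i) <= b) -> enorm (\sum_i a i *: G i) <= M * b.
Proof.
move=> b0 Gb; apply: le_trans (enorm_sum _) _.
apply: (@le_trans _ _ (\sum_i `|a i| * b)).
  by apply: ler_sum => i _; rewrite enormZ ler_wpM2l.
by rewrite -mulr_suml ler_wpM2r.
Qed.

Let mixtureB (G : I -> 'rV[R]_n) (p : 'rV[R]_n) :
  \sum_i a i *: G i - p = \sum_i a i *: (G i - p).
Proof.
under [RHS]eq_bigr do rewrite scalerBr.
by rewrite sumrB -scaler_suml a_sum scale1r.
Qed.

Hypothesis D_ge0 : 0 <= D.
Hypothesis rho_e : rho + e <= 1.

Lemma mixture_dist_le : enorm (y' - ys) <= M * D.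
Proof.
rewrite mixtureB; apply: mixture_le => // i.
apply: le_trans (image_dist_le (zd i)) _; apply: le_trans (zD i).
by rewrite ler_piMl// enorm_ge0.
Qed.

(** To first order F y' = (sum_i a_i F (z_i)) A: both sides are the image of the
    mixed error sum_i a_i (z_i - ys) under A (A - 1), because A commutes with
    A - 1.  The corrections come from linearizing g at the z_i and at y'. *)
Lemma mixture_residual_le : enorm (y' - ys) <= d ->
  enorm (F y') <= rho * enorm (\sum_i a i *: F (z i)) + 2 * e * M * D.
Proof.
move=> y'd.
pose err p := g p - ys - (p - ys) *m A.
have gE p : g p = ys + (p - ys) *m A + err p.
  by rewrite /err; move: (_ *m A) => X; apply/rowP => j; rewrite !mxE; ring.
pose s := \sum_i a i *: err (z i).
pose E := \sum_i a i *: (z i - ys).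
have y'E : y' - ys = E *m A + s.
  rewrite mixtureB mulmx_suml -big_split/=; apply: eq_bigr => i _.
  by rewrite -scalemxAl -scalerDr /err [_ *m A + _]addrC subrK.
have FE : \sum_i a i *: F (z i) = E *m A + s - E.
  rewrite -y'E mixtureB -sumrB; apply: eq_bigr => i _.
  by rewrite -scalerBr /F opprB addrA subrK.
have -> : F y' = (\sum_i a i *: F (z i)) *m A + (err y' - s).
  rewrite FE /F gE y'E mulmxBl mulmxDl; move: (err y') => q.
  rewrite -[y'](subrK ys) y'E; clearbody s E.
  by apply/rowP => j; rewrite !mxE; ring.
apply: le_trans (enormD _ _) _; apply: lerD; first exact: spectral_norm_le.
apply: le_trans (enormB _ _) _.
have -> : 2 * e * M * D = e * (M * D) + M * (e * D) by ring.
apply: lerD.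
  apply: le_trans (g_approx y'd) _; apply: ler_wpM2l => //.
  exact: mixture_dist_le.
apply: mixture_le => [|i]; first exact: mulr_ge0.
apply: le_trans (g_approx (zd i)) _; exact: ler_wpM2l.
Qed.

End MixingStep.

(** * Convergence rates *)

Section Rates.
Variable R : realType.
Implicit Types (u : nat -> R) (C r rho eta : R).

(** If u decays like r^k up to k, its maximum over the last m terms is at most
    r^-m times the bound at k, hence a coefficient eta <= (r - rho) r^m only
    raises the rate from rho to r.  The recursion may hold only as long as the
    iterates stay in some region: J is such an invariant, established along with
    the rate. *)
Lemma delayed_contraction u (J : nat -> Prop) C rho r eta (m K : nat) :
  0 <= C -> 0 <= rho -> 0 < r <= 1 -> eta <= (r - rho) * r ^+ m ->
  (forall j, (j <= K)%N -> J j /\ u j <= C * r ^+ j) ->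
  (forall k, (K <= k)%N -> (forall j, (j <= k)%N -> J j /\ u j <= C * r ^+ j) ->
     J k.+1 /\ forall B, (forall i, (i <= minn m k)%N -> u (k - i)%N <= B) ->
       u k.+1 <= rho * u k + eta * B) ->
  forall k, J k /\ u k <= C * r ^+ k.
Proof.
move=> C0 rho0 /andP[r0 r1] eta_le base step k.
elim/ltn_ind: k => k IH.
have [/base//|] := leqP k K; case: k IH => // k IH kK.
have [|Jk uk] := step k kK; first by move=> j jk; apply: IH.
split=> //.
have rm0 : 0 < r ^+ m by rewrite exprn_gt0.
have /uk/le_trans : forall i, (i <= minn m k)%N ->
    u (k - i)%N <= C * r ^+ k / r ^+ m.
  move=> i; rewrite leq_min => /andP[im ik].
  have [|_ /le_trans] := IH (k - i)%N; first by rewrite ltnS leq_subr.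
  apply; rewrite -mulrA ler_wpM2l// ler_pdivlMr// -{2}(subnK ik) exprD.
  apply: ler_wpM2l; first exact: exprn_ge0 (ltW r0).
  by apply: ler_wiXn2l => //; exact: ltW.
apply.
have ukC := (IH k (ltnSn k)).2.
apply: (@le_trans _ _ (rho * (C * r ^+ k) + (r - rho) * r ^+ m * (C * r ^+ k / r ^+ m))).
  apply: lerD; first exact: ler_wpM2l.
  apply: ler_wpM2r => //; apply: divr_ge0; last exact: ltW.
  by apply: mulr_ge0 => //; exact: exprn_ge0 (ltW r0).
have -> : (r - rho) * r ^+ m * (C * r ^+ k / r ^+ m) = (r - rho) * (C * r ^+ k).
  by field; rewrite gt_eqF.
by rewrite exprS -mulrDl addrC subrK mulrCA.
Qed.

(** The prefactor C / D disappears under the k-th root: it is absorbed by passing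
    to a slightly larger rate.  With D = 0 all quotients are 0. *)
Lemma limn_esup_root_le u rho (D : R) : 0 <= rho < 1 -> 0 <= D ->
  (forall k, 0 <= u k) ->
  (forall r, rho < r < 1 -> exists C, forall k, u k <= C * r ^+ k) ->
  (limn_esup (fun k => ((u k / D) `^ (k%:R^-1))%:E) <= rho%:E)%E.
Proof.
move=> /andP[rho0 rho1] D0 u0 u_rate; apply: limn_esup_le => b rho_b.
(* the hypothesis only provides rates below 1 *)
pose c := Num.min b 1; pose r := (rho + c) / 2.
have rho_c : rho < c by rewrite /c lt_min rho_b.
have c1 : c <= 1 by rewrite /c ge_min lexx orbT.
have rc : r < c by rewrite /r; lra.
have [|C uC] := u_rate r; first by rewrite /r; apply/andP; split; lra.
have c0 : 0 < c by exact: le_lt_trans rho_c.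
have q_cvg : C / D * (r / c) ^+ k @[k --> \oo] --> C / D * 0.
  apply: cvgM; first exact: cvg_cst.
  have r0 : 0 <= r by rewrite /r; lra.
  apply: cvg_expr; rewrite ger0_norm; last exact: divr_ge0 (ltW c0).
  by rewrite ltr_pdivrMr// mul1r.
move: q_cvg; rewrite mulr0 => /cvgr0Pnorm_le/(_ 1 ltr01) q_le.
near=> k; have k0 : (0 < k)%N by near: k; exact: nbhs_infty_gt.
rewrite lee_fin; apply: (@le_trans _ _ c); last by rewrite /c ge_min lexx.
have -> : c = (c ^+ k) `^ (k%:R^-1).
  by rewrite -powR_mulrn ?ltW// -powRrM mulfV ?powRr1 ?ltW// pnatr_eq0 -lt0n.
apply: ge0_ler_powR; first by rewrite invr_ge0.
- by rewrite nnegrE divr_ge0.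
- by rewrite nnegrE exprn_ge0// ltW.
apply: (@le_trans _ _ (C / D * r ^+ k)).
  by rewrite mulrAC ler_wpM2r ?invr_ge0.
have : `|C / D * (r / c) ^+ k| <= 1 by near: k; exact: q_le.
move=> /(le_trans (ler_norm _)).
by rewrite expr_div_n mulrA ler_pdivrMr ?exprn_gt0// mul1r.
Unshelve. all: by end_near. Qed.

End Rates.

(** * Local convergence of Anderson mixing *)

Section Anderson.
Variables (R : realType) (n : nat) (g : 'rV[R]_n -> 'rV[R]_n).
Let F z := g z - z.

(** The last condition is what remains of the optimality of the weights: they do
    at least as well as putting all the weight on the current iterate. *)
Definition residual_mixing (M : R) (m : nat) (y : nat -> 'rV[R]_n) :=
  forall k, exists a : 'I_(minn m k).+1 -> R,
  [/\ \sum_i a i = 1, \sum_i `|a i| <= M,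
      y k.+1 = \sum_i a i *: g (y (k - i)%N) &
      enorm (\sum_i a i *: F (y (k - i)%N)) <= enorm (F (y k))].

Variables (ys : 'rV[R]_n) (A : 'M[R]_n).
Let rho := spectral_norm A.
Hypotheses (g_ys : g ys = ys) (g_diff : linear_approx g ys A) (rho_lt1 : rho < 1).
Variables (M : R) (m : nat).
Hypothesis M_ge1 : 1 <= M.

Let rho_ge0 : 0 <= rho. Proof. exact: spectral_norm_ge0. Qed.
(* to first order y - ys is F y times the inverse of A - 1, whose norm is at most
   1 / (1 - rho); the factor 2 leaves room for the linearization error. *)
Let kappa := 2 / (1 - rho).

Let kappa_gt0 : 0 < kappa.
Proof. by rewrite divr_gt0// subr_gt0. Qed.

(** At the rate r the linearization error eps has to satisfy the condition of
    [delayed_contraction] and to keep residuals comparable to errors; delta is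
    the radius on which it is achieved. *)
Let linearization_radius r : rho < r < 1 -> exists eps, exists2 delta, 0 < delta &
  [/\ 0 <= eps, eps <= (1 - rho) / 2,
      2 * eps * M * kappa <= (r - rho) * r ^+ m &
      forall z, enorm (z - ys) <= delta ->
        enorm (g z - ys - (z - ys) *m A) <= eps * enorm (z - ys)].
Proof.
move=> /andP[rho_r r1]; have r0 : 0 < r by exact: le_lt_trans rho_r.
have M0 : 0 < M by exact: lt_le_trans ltr01 M_ge1.
have MK : 0 < 2 * M * kappa by rewrite mulr_gt0 ?kappa_gt0 ?mulr_gt0.
pose eps := Num.min ((1 - rho) / 2) ((r - rho) * r ^+ m / (2 * M * kappa)).
have eps0 : 0 < eps.
  rewrite /eps lt_min; apply/andP; split; apply: divr_gt0 => //.
    by rewrite subr_gt0.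
  by apply: mulr_gt0; rewrite ?subr_gt0// exprn_gt0.
have [delta delta0 gP] := g_diff eps0.
exists eps; exists delta => //; split; first exact: ltW.
- by rewrite /eps ge_min lexx.
- have -> : 2 * eps * M * kappa = eps * (2 * M * kappa) by ring.
  by rewrite -ler_pdivlMr// /eps ge_min lexx orbT.
- by move=> z /gP; rewrite g_ys.
Qed.

Section Step.
Variables (eps delta : R).
Hypotheses (eps_ge0 : 0 <= eps) (eps_le : eps <= (1 - rho) / 2)
  (gP : forall z, enorm (z - ys) <= delta ->
        enorm (g z - ys - (z - ys) *m A) <= eps * enorm (z - ys)).

Lemma dist_le_scaled_residual z : enorm (z - ys) <= delta ->
  enorm (z - ys) <= kappa * enorm (F z).
Proof.
move=> /(dist_le_residual gP) zF; rewrite -mulrA -ler_pdivrMl//.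
rewrite mulrC ler_pdivlMl ?subr_gt0// mulrC -/rho.
have := ler_wpM2r (enorm_ge0 (z - ys)) eps_le; rewrite -/rho in zF; lra.
Qed.

Lemma residual_le_scaled_dist z : enorm (z - ys) <= delta ->
  enorm (F z) <= (3 + rho) / 2 * enorm (z - ys).
Proof.
move=> /(residual_le_dist gP); rewrite -/rho => /le_trans; apply.
by rewrite ler_wpM2r ?enorm_ge0//; move: eps_le rho_lt1; lra.
Qed.

Let mixing_dist_le y k D : residual_mixing M m y ->
  (forall i, (i <= minn m k)%N -> enorm (y (k - i)%N - ys) <= delta) ->
  (forall i, (i <= minn m k)%N -> enorm (y (k - i)%N - ys) <= D) ->
  enorm (y k.+1 - ys) <= M * D.
Proof.
move=> /(_ k)[a [a1 aM -> _]] yd yD.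
apply: (mixture_dist_le gP) => //.
- by move=> i; apply: yd; rewrite -ltnS.
- by move=> i; apply: yD; rewrite -ltnS.
- exact: le_trans (enorm_ge0 _) (yD 0%N isT).
- by rewrite -/rho; move: eps_le rho_lt1; lra.
Qed.

Let mixing_residual_le y k B : residual_mixing M m y ->
  (forall i, (i <= minn m k)%N -> enorm (y (k - i)%N - ys) <= delta) ->
  enorm (y k.+1 - ys) <= delta ->
  (forall i, (i <= minn m k)%N -> enorm (F (y (k - i)%N)) <= B) ->
  enorm (F (y k.+1)) <= rho * enorm (F (y k)) + 2 * eps * M * kappa * B.
Proof.
move=> /(_ k)[a [a1 aM -> aF]] yd y'd yB.
have B0 : 0 <= B by exact: le_trans (enorm_ge0 _) (yB 0%N isT).
have le_m (i : 'I_(minn m k).+1) : (i <= minn m k)%N by rewrite -ltnS.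
have aD (i : 'I_(minn m k).+1) : enorm (y (k - i)%N - ys) <= kappa * B.
  apply: le_trans (dist_le_scaled_residual (yd _ (le_m i))) _.
  by apply: ler_wpM2l; [exact: ltW|exact: yB].
have rho_eps : spectral_norm A + eps <= 1.
  by rewrite -/rho; move: eps_le rho_lt1; lra.
apply: le_trans (mixture_residual_le eps_ge0 gP a1 aM
  (fun i => yd _ (le_m i)) aD _ rho_eps y'd) _.
  by rewrite mulr_ge0// ltW.
by rewrite -/rho mulrA lerD2r; exact: ler_wpM2l.
Qed.

(** The rate and the confinement to the ball of radius delta support each other:
    the rate bounds all previous errors by a multiple of the initial one, and a
    mixture multiplies the largest error by at most M. *)
Lemma mixing_rate_small y r : 0 < r <= 1 ->
  2 * eps * M * kappa <= (r - rho) * r ^+ m ->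
  residual_mixing M m y -> 
  M * (kappa * ((3 + rho) / 2 * enorm (y 0%N - ys))) <= delta ->
  forall k, enorm (y k - ys) <= delta /\
    enorm (F (y k)) <= enorm (F (y 0%N)) * r ^+ k.
Proof.
move=> r01 eta_le y_mix y0.
have M0 : 0 <= M by exact: le_trans ler01 M_ge1.
have y0d : enorm (y 0%N - ys) <= delta.
  apply: le_trans y0; have e0 := enorm_ge0 (y 0%N - ys).
  have kappa_ge2 : 2 <= kappa by rewrite ler_pdivlMr ?subr_gt0//; move: rho_ge0; lra.
  rewrite -[leLHS]mul1r; apply: ler_pM => //; rewrite mulrA.
  rewrite ler_peMl// mulrA ler_pdivlMr// mul1r.
  by apply: le_trans kappa_ge2 _; rewrite ler_peMr// ?(ltW kappa_gt0)//; move: rho_ge0; lra.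
apply: (delayed_contraction (eta := 2 * eps * M * kappa) (rho := rho)
  (m := m) (K := 0%N)) => //; first exact: enorm_ge0.
  by case=> // _; rewrite expr0 mulr1.
move=> k _ yk.
have y_close i : (i <= minn m k)%N -> enorm (y (k - i)%N - ys) <= delta.
  by move=> _; have [] := yk (k - i)%N (leq_subr _ _).
have y'd : enorm (y k.+1 - ys) <= delta.
  apply: le_trans y0.
  apply: (mixing_dist_le y_mix y_close) => i im.
  apply: le_trans (dist_le_scaled_residual (y_close _ im)) _; apply: ler_wpM2l; first exact: ltW.
  apply: le_trans (residual_le_scaled_dist y0d).
  have [_ /le_trans] := yk (k - i)%N (leq_subr _ _); apply.
  case/andP: r01 => r0 r1; rewrite ler_piMr ?enorm_ge0// exprn_ile1//.
  exact: ltW.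
split=> // B; exact: mixing_residual_le.
Qed.

(** Once the last m + 1 iterates are in the ball of radius delta, which K + m
    ensures, the recursion runs; a large constant takes care of the beginning. *)
Lemma mixing_rate_eventually y r K : 0 < r <= 1 ->
  2 * eps * M * kappa <= (r - rho) * r ^+ m ->
  residual_mixing M m y ->
  (forall k, (K <= k)%N -> enorm (y k - ys) <= delta) ->
  exists C, forall k, enorm (F (y k)) <= C * r ^+ k.
Proof.
move=> r01 eta_le y_mix yK; have r0 := (andP r01).1.
pose C := \sum_(j < (K + m).+1) enorm (F (y j)) / r ^+ j.
have C_term (j : 'I_(K + m).+1) : 0 <= enorm (F (y j)) / r ^+ j.
  by rewrite divr_ge0 ?enorm_ge0 ?exprn_ge0 ?ltW.
exists C => k.
suff [] : True /\ enorm (F (y k)) <= C * r ^+ k by [].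
move: k; apply: (delayed_contraction (eta := 2 * eps * M * kappa) (rho := rho)
  (m := m) (K := K + m)) => //.
- exact: sumr_ge0.
- move=> j jK; split=> //; rewrite -ler_pdivrMr ?exprn_gt0//.
  rewrite /C (bigD1 (inord j))//= inordK ?ltnS// lerDl.
  exact: sumr_ge0.
- move=> k Kk _; split=> // B; apply: mixing_residual_le => // [i|].
    rewrite leq_min => /andP[im _]; apply: yK.
    apply: leq_trans (leq_sub2l k im).
    by rewrite -{1}(addnK m K) leq_sub2r.
  by apply: yK; rewrite (leq_trans (leq_addr m K))// (leq_trans Kk).
Qed.

End Step.

(** The ball of the rate r serves for the explicit bounds.  They imply
    convergence, so that the iterates eventually enter the smaller ball that
    belongs to any other rate s > rho. *)
Theorem mixing_local_convergence r : rho < r < 1 ->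
  \forall y0 \near ys, forall y, y 0%N = y0 -> residual_mixing M m y ->
  [/\ forall k, enorm (F (y k)) <= r ^+ k * enorm (F (y 0%N)),
      forall k, enorm (y k - ys) <=
        (3 + rho) / (1 - rho) * r ^+ k * enorm (y 0%N - ys) &
      forall s, rho < s < 1 -> exists C, forall k,
        enorm (F (y k)) <= C * s ^+ k /\ enorm (y k - ys) <= C * s ^+ k].
Proof.
move=> r_in; have [eps [delta delta0 [eps0 eps_le eta_le gP]]] := linearization_radius r_in.
have /andP[rho_r r1] := r_in; have r0 : 0 < r by exact: le_lt_trans rho_r.
have M0 : 0 < M by exact: lt_le_trans M_ge1.
have c0 : 0 < M * (kappa * ((3 + rho) / 2)).
  apply: mulr_gt0 => //; apply: mulr_gt0; first exact: kappa_gt0.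
  by apply: divr_gt0 => //; move: rho_ge0; lra.
apply/near_enormP; exists (delta / (M * (kappa * ((3 + rho) / 2)))).
  exact: divr_gt0.
move=> y0 y0_near y y0E y_mix; rewrite -y0E in y0_near.
have small : M * (kappa * ((3 + rho) / 2 * enorm (y 0%N - ys))) <= delta.
  by move: y0_near; rewrite ler_pdivlMr// mulrC -!mulrA.
have rate := mixing_rate_small eps0 eps_le gP _ eta_le y_mix small.
have {}rate k := rate (introT andP (conj r0 (ltW r1))) k.
have y_le k : enorm (y k - ys) <=
    (3 + rho) / (1 - rho) * r ^+ k * enorm (y 0%N - ys).
  apply: le_trans (dist_le_scaled_residual eps_le gP (rate k).1) _.
  apply: le_trans (ler_wpM2l (ltW kappa_gt0) (rate k).2) _.
  have := residual_le_scaled_dist eps_le gP (rate 0%N).1.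
  move/(ler_wpM2r (exprn_ge0 k (ltW r0)))/(ler_wpM2l (ltW kappa_gt0))/le_trans.
  apply; rewrite [leLHS](_ : _ = (3 + rho) / (1 - rho) * r ^+ k * enorm (y 0%N - ys))//.
  by rewrite /kappa; field; rewrite gt_eqF// subr_gt0.
split=> // [k|s s_in]; first by rewrite mulrC; exact: (rate k).2.
have /andP[rho_s s1] := s_in; have s0 : 0 < s by exact: le_lt_trans rho_s.
have [eps' [delta' delta'0 [eps'0 eps'_le eta'_le gP']]] := linearization_radius s_in.
have [K yK] : exists K, forall k, (K <= k)%N -> enorm (y k - ys) <= delta'.
  have : (3 + rho) / (1 - rho) * enorm (y 0%N - ys) * r ^+ k @[k --> \oo] -->
     (3 + rho) / (1 - rho) * enorm (y 0%N - ys) * 0.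
    apply: cvgM; first exact: cvg_cst.
    by apply: cvg_expr; rewrite ger0_norm// ltW.
  rewrite mulr0 => /cvgr0Pnorm_le/(_ _ delta'0)[K _ yK].
  exists K => k /yK /(le_trans (ler_norm _)); apply: le_trans.
  by apply: le_trans (y_le k) _; rewrite mulrAC.
have [|C FC] := mixing_rate_eventually eps'0 eps'_le gP' _ eta'_le y_mix yK.
  by rewrite s0 ltW.
have C0 : 0 <= C by have := le_trans (enorm_ge0 _) (FC 0%N); rewrite expr0 mulr1.
exists ((1 + kappa) * C) => k; split.
  apply: le_trans (FC k) _; rewrite ler_wpM2r ?exprn_ge0 ?(ltW s0)//.
  by rewrite ler_peMl// lerDl ltW// kappa_gt0.
apply: le_trans (dist_le_scaled_residual eps_le gP (rate k).1) _.
apply: le_trans (ler_wpM2l (ltW kappa_gt0) (FC k)) _.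
rewrite mulrA ler_wpM2r ?exprn_ge0 ?(ltW s0)// ler_wpM2r//.
by rewrite lerDr.
Qed.

End Anderson.

(** * The accelerated proximal gradient method *)

Lemma aa_pga_residual_mixing (R : realType) (n : nat)
    (gradf px : 'rV[R]_n -> 'rV[R]_n) (gamma : R) (m : nat)
    (x y : nat -> 'rV[R]_n) (alpha : forall k : nat, 'rV[R]_(minn m k).+1)
    (Malpha : R) :
  aa_pga (@enorm R n) gradf px gamma x y alpha ->
  (forall k, (0 < k)%N -> \sum_i `|alpha k 0 i| <= Malpha) ->
  residual_mixing (pga_map gradf px gamma) (Num.max 1 Malpha) m y.
Proof.
move=> [xE y1 alpha1 alpha_min y_step] alpha_le.
have gE k : grad_step gradf gamma (x k) = pga_map gradf px gamma (y k).
  by rewrite /pga_map xE.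
(* weights that select the current iterate: they define y 1 and compete with
   the optimal weights at every later step *)
pose e0 k (i : 'I_(minn m k).+1) : R := (i == ord0)%:R.
have sum_e0 k (V : lmodType R) (G : 'I_(minn m k).+1 -> V) :
    \sum_i e0 k i *: G i = G ord0.
  rewrite (bigD1 ord0)//= /e0 eqxx scale1r big1 ?addr0// => i /negbTE ->.
  by rewrite scale0r.
have residualE k (a : 'rV[R]_(minn m k).+1) :
    a *m residual_mx gradf gamma x y m k =
    \sum_i a 0 i *: (pga_map gradf px gamma (y (k - i)%N) - y (k - i)%N).
  rewrite mulmx_sum_row; apply: eq_bigr => i _; congr (_ *: _).
  by rewrite rowK gE.
have sum1_e0 k : \sum_i e0 k i = 1.
  by have := sum_e0 k R^o (fun=> 1); under eq_bigr do rewrite [_ *: _]mulr1.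
case=> [|k].
  exists (e0 0%N); split.
  - exact: sum1_e0.
  - under eq_bigr do rewrite /e0 normr_nat.
    by rewrite [leLHS]sum1_e0 le_max lexx.
  - by rewrite y1 gE sum_e0.
  - by rewrite sum_e0.
exists (fun i => alpha k.+1 0 i); split.
- exact: alpha1.
- by rewrite le_max alpha_le ?orbT.
- by rewrite y_step//; apply: eq_bigr => i _; rewrite gE.
- have := alpha_min k.+1 isT (\row_i e0 k.+1 i).
  rewrite !residualE.
  under [X in X = _ -> _]eq_bigr do rewrite mxE.
  move=> /(_ (sum1_e0 _))/le_trans; apply.
  under eq_bigr do rewrite mxE.
  by rewrite sum_e0.
Qed.

(* 0 / 0 = 0 in the last two conclusions: a vanishing denominator makes every
   numerator vanish. *)
Theorem theorem1 (R : realType) (n : nat)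
  (f : 'rV[R]_n -> R) (L : R) (h : 'rV[R]_n -> \bar R)
  (xstar : 'rV[R]_n) (nu : R) (S : {vspace 'rV[R]_n}) (Q : 'M[R]_n)
  (gamma : R)
  (f_convex : convex_function setT f)
  (f_diff : forall x, differentiable f x)
  (f_smooth : lsmooth L f)
  (h_proper : proper_efun h)
  (h_closed : lower_semicontinuous h)
  (h_convex : ext_convex h)
  (xstar_min : argmin (fun x => (f x)%:E + h x)%E xstar)
  (f_C2 : class_C2_around f xstar)
  (nu_gt0 : 0 < nu)
  (f_hess : forall xi : 'rV[R]_n,
     nu * dot xi xi <= dot xi (xi *m hessian f xstar))
  (h_epi2 : twice_epi_differentiable h xstar (- grad f xstar))
  (Q_sym : Q^T = Q)
  (h_gq : is_second_epi_derivative h xstar (- grad f xstar)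
            (generalized_quadratic S Q))
  (gamma_range : 0 < gamma <= L^-1) :
  let px := prox gamma h in
  let g := pga_map (grad f) px gamma in
  let F := fun y => g y - y in
  let ystar := xstar - gamma *: grad f xstar in
  let rho := spectral_norm ('J g ystar) in
  [/\ g ystar = ystar,
      differentiable g ystar &
      forall rhohat : R, rho < rhohat < 1 ->
      forall (m : nat) (Malpha : R),
      \forall y0 \near ystar,
      forall (x y : nat -> 'rV[R]_n)
             (alpha : forall k : nat, 'rV[R]_(minn m k).+1),
        y 0%N = y0 ->
        aa_pga (@enorm R n) (grad f) px gamma x y alpha ->
        (forall k, (0 < k)%N -> \sum_i `|alpha k 0 i| <= Malpha) ->
        [/\ forall k, enorm (F (y k)) <= rhohat ^+ k * enorm (F (y 0%N)),
            forall k, enorm (x k - xstar) <=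
              (3 + rho) / (1 - rho) * rhohat ^+ k * enorm (y 0%N - ystar),
            (limn_esup (fun k =>
               ((enorm (F (y k)) / enorm (F (y 0%N))) `^ (k%:R^-1))%:E)
             <= rho%:E)%E &
            (limn_esup (fun k =>
               ((enorm (x k - xstar) / enorm (x 0%N - xstar)) `^ (k%:R^-1))%:E)
             <= rho%:E)%E]].
Proof.
move=> px g F ystar rho.
have gamma_gt0 : 0 < gamma by case/andP: gamma_range.
have xv : subgradient h xstar (- grad f xstar).
  exact: argmin_subgradient (f_diff _) h_convex h_proper xstar_min.
have ystarE : ystar = xstar + gamma *: (- grad f xstar).
  by rewrite scalerN.
have px_ystar : px ystar = xstar.
  apply: (prox_unique gamma_gt0 h_proper h_closed h_convex xv).
  by rewrite ystarE addrAC subrr add0r scalerA mulVf ?gt_eqF// scale1r.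
have g_ystar : g ystar = ystar by rewrite /g /pga_map px_ystar.
have px_diff : differentiable px ystar.
  rewrite ystarE.
  exact: (prox_differentiable gamma_gt0 h_proper h_closed h_convex xv Q_sym h_gq).
have grad_diff : differentiable (grad f) xstar.
  by have [] := nbhs_singleton f_C2.
have g_diff : differentiable g ystar.
  apply: (@differentiable_comp _ _ _ _ px (grad_step (grad f) gamma)) => //.
  rewrite px_ystar; apply: differentiableB => //.
  exact: differentiableZ.
split=> // rhohat rhohat_in m Malpha.
have [rho_lt rhohat_lt] := andP rhohat_in.
have rho_lt1 : rho < 1 := lt_trans rho_lt rhohat_lt.
have M_ge1 : 1 <= Num.max 1 Malpha by rewrite le_max lexx.
have := mixing_local_convergence g_ystar (differentiable_linear_approx g_diff)
  rho_lt1 m M_ge1 rhohat_in.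
apply: filterS => y0 conv x y alpha y0E run alpha_le.
have [F_le y_le rates] := conv y y0E (aa_pga_residual_mixing run alpha_le).
have x_le k : enorm (x k - xstar) <= enorm (y k - ystar).
  rewrite (aa_prox run) -px_ystar.
  exact: (prox_nonexpansive gamma_gt0 h_proper h_closed h_convex _ _ xv).
have rho_in : 0 <= rho < 1 by rewrite spectral_norm_ge0.
split=> // [k||].
- exact: le_trans (x_le k) (y_le k).
- apply: limn_esup_root_le => // [|k|r /rates[C CP]]; rewrite ?enorm_ge0//.
  by exists C => k; have [] := CP k.
- apply: limn_esup_root_le => // [|k|r /rates[C CP]]; rewrite ?enorm_ge0//.
  by exists C => k; apply: le_trans (x_le k) (CP k).2.
Qed.
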